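(* Let $p\ge1$. If $E$ is a discrete Banach lattice then $E_{(p)}$ is a normed lattice, i.e. the lattice seminorm $\|\cdot\|_{(p)}$ is a norm on $E_{(p)}$.
   Context: All Banach lattices are real. An element $x>0$ of a Banach lattice $E$ is an atom if $0\le z\le x$ implies that $z$ is a scalar multiple of $x$. $E$ is discrete (atomic) if for every $z>0$ there exists an atom $x$ with $0<x\le z$. Functional calculus: for $x_1,\dots,x_n$ in a Banach lattice $E$ there is a unique lattice homomorphism $\tau$ from the space of continuous homogeneous functions $f\colon\mathbb R^n\to\mathbb R$ (homogeneous: $f(\lambda t)=\lambda f(t)$ for all $\lambda\ge 0$) to $E$ sending the $i$-th coordinate function to $x_i$; one writes $f(x_1,\dots,x_n)=\tau(f)$. Convention: for $t\in\mathbb R$ and $p>0$, $t^p$ means $|t|^p\operatorname{sign}t$. $p$-concavification: on $E$ define new operations $x\oplus y=(x^p+y^p)^{1/p}$ and $\alpha\odot x=\alpha^{1/p}x$ ($x,y\in E$, $\alpha\in\mathbb R$), with the signed-power convention. With these operations and the original order $E$ is a vector lattice, and $\|x\|_{(p)}=\inf\{\sum_{i=1}^n\|v_i\|^p : |x|\le v_1\oplus\dots\oplus v_n,\ v_i\ge 0\}$ is a lattice seminorm on it. The resulting seminormed vector lattice is $E_{(p)}$. *)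

(* Defs.v *)
From HB Require Import structures.
From mathcomp Require Import all_boot all_order all_algebra.
From mathcomp Require Import all_classical all_reals all_analysis.

Set Implicit Arguments.
Unset Strict Implicit.
Unset Printing Implicit Defensive.

Import Order.TTheory GRing.Theory Num.Theory.
Import numFieldNormedType.Exports.

Local Open Scope ring_scope.

(* The order is a field rather than an inherited [latticeType] structure
   because numeric domains already carry both a norm and a [ring_display]
   order, and a second structure joining these two cannot be added to the
   hierarchy after them. The [latticeType] structure is derived below. *)
HB.mixin Record isBanachLattice (R : realType) E of CompleteNormedModule R E := {
  bl_le : rel E;
  bl_meet : E -> E -> E;
  bl_join : E -> E -> E;
  bl_le_refl : reflexive bl_le;
  bl_le_anti : antisymmetric bl_le;
  bl_le_trans : transitive bl_le;
  bl_lexI : forall x y z, bl_le x (bl_meet y z) = bl_le x y && bl_le x z;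
  bl_leUx : forall x y z, bl_le (bl_join x y) z = bl_le x z && bl_le y z;
  bl_leD2r : forall x y z, bl_le x y -> bl_le (x + z) (y + z);
  bl_scale_ge0 : forall (a : R) x, 0 <= a -> bl_le 0 x -> bl_le 0 (a *: x);
  bl_norm_le : forall x y : E,
    bl_le (bl_join x (- x)) (bl_join y (- y)) -> `|x| <= `|y|
}.

#[short(type="banachLatticeType")]
HB.structure Definition BanachLattice (R : realType) :=
  { E of CompleteNormedModule R E & isBanachLattice R E }.

Section BanachLatticeOrder.
Variables (R : realType) (E : banachLatticeType R).

#[non_forgetful_inheritance]
HB.instance Definition _ := Order.Le_isPOrder.Build ring_display E
  (@bl_le_refl R E) (@bl_le_anti R E) (@bl_le_trans R E).
#[non_forgetful_inheritance]
HB.instance Definition _ :=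
  Order.POrder_isMeetSemilattice.Build ring_display E (@bl_lexI R E).
#[non_forgetful_inheritance]
HB.instance Definition _ :=
  Order.POrder_isJoinSemilattice.Build ring_display E (@bl_leUx R E).

End BanachLatticeOrder.

(* The negation is a parameter because concavification changes the linear
   structure but keeps the order. *)
Definition modulus (T : latticeType ring_display) (opp : T -> T) (x : T) : T :=
  Order.join x (opp x).

Section Discrete.
Variables (R : realType) (E : banachLatticeType R).

Definition atom (x : E) : Prop :=
  0 < x /\ forall z : E, 0 <= z -> z <= x -> exists a : R, z = a *: x.

Definition discrete_lattice : Prop :=
  forall z : E, 0 < z -> exists x : E, atom x /\ x <= z.

End Discrete.

Section RawLattices.
Variables (R : realType) (T : latticeType ring_display).
Variables (zero : T) (add : T -> T -> T) (scale : R -> T -> T) (N : T -> R).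

(* The given order of [T] is a lattice order; the linear operations are
   arbitrary functions, with [scale (-1)] as the negation. *)
Record is_vector_lattice : Prop := IsVectorLattice {
  vl_addA : associative add;
  vl_addC : commutative add;
  vl_add0 : left_id zero add;
  vl_addN : forall x, add (scale (-1) x) x = zero;
  vl_scaleA : forall a b x, scale a (scale b x) = scale (a * b) x;
  vl_scale1 : forall x, scale 1 x = x;
  vl_scaleDr : forall a x y, scale a (add x y) = add (scale a x) (scale a y);
  vl_scaleDl : forall a b x, scale (a + b) x = add (scale a x) (scale b x);
  vl_leD2r : forall x y z, x <= y -> add x z <= add y z;
  vl_scale_ge0 : forall a x, 0 <= a -> zero <= x -> zero <= scale a x
}.

Record is_lattice_seminorm : Prop := IsLatticeSeminorm {
  ls_ge0 : forall x, 0 <= N x;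
  ls_add : forall x y, N (add x y) <= N x + N y;
  ls_scale : forall a x, N (scale a x) = `|a| * N x;
  ls_le : forall x y,
    modulus (scale (-1)) x <= modulus (scale (-1)) y -> N x <= N y
}.

Record is_normed_lattice : Prop := IsNormedLattice {
  nl_vector_lattice : is_vector_lattice;
  nl_seminorm : is_lattice_seminorm;
  nl_eq0 : forall x, N x = 0 -> x = zero
}.

End RawLattices.

Section FunctionalCalculus.
Variables (R : realType) (E : banachLatticeType R).

Definition homogeneous_continuous (n : nat) (f : 'rV[R]_n -> R) : Prop :=
  continuous f /\ forall (a : R) t, 0 <= a -> f (a *: t) = a * f t.

(* [tau] is constrained only on continuous homogeneous functions; its values
   elsewhere are irrelevant. *)
Record is_functional_calculus (n : nat) (x : n.-tuple E)
    (tau : ('rV[R]_n -> R) -> E) : Prop := IsFunctionalCalculus {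
  fc_linear : forall (a : R) f g,
    homogeneous_continuous f -> homogeneous_continuous g ->
    tau (fun t => a * f t + g t) = a *: tau f + tau g;
  fc_join : forall f g,
    homogeneous_continuous f -> homogeneous_continuous g ->
    tau (fun t => Num.max (f t) (g t)) = Order.join (tau f) (tau g);
  fc_meet : forall f g,
    homogeneous_continuous f -> homogeneous_continuous g ->
    tau (fun t => Num.min (f t) (g t)) = Order.meet (tau f) (tau g);
  fc_coord : forall i : 'I_n, tau (fun t => t ord0 i) = tnth x i
}.

(* [fcalc x f] is f(x_1, ..., x_n) for f continuous and homogeneous. The
   homomorphism exists and is unique on such f by Krivine's theorem, so the
   default value of [xget] is never used there. *)
Definition fcalc (n : nat) (x : n.-tuple E) (f : 'rV[R]_n -> R) : E :=
  xget 0 [set z | exists2 tau, is_functional_calculus x tau & z = tau f].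

End FunctionalCalculus.

(* t^p := |t|^p sign t *)
Definition spow (R : realType) (t p : R) : R := `|t| `^ p * Num.sg t.

Section Concavification.
Variables (R : realType) (E : banachLatticeType R) (p : R).

Definition conc_add (x y : E) : E :=
  fcalc [tuple x; y]
    (fun t => spow (spow (t ord0 ord0) p + spow (t ord0 ord_max) p) p^-1).

Definition conc_scale (a : R) (x : E) : E := spow a p^-1 *: x.

Definition conc_norm (x : E) : R :=
  inf [set s : R | exists (v : E) (vs : seq E),
    [/\ all (fun w => 0 <= w) (v :: vs),
        modulus (T := E) -%R x <= foldl conc_add v vs
      & s = \sum_(w <- v :: vs) `|w| `^ p]].

End Concavification.

(* Main.v *)
(* If a is an atom of a Banach lattice E, every x differs from a multiple
   coord_a(x) a by an element disjoint from a, and coord_a is a norm-bounded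
   real lattice homomorphism. When E is discrete these functionals determine
   the order. Hence f(x_1, ..., x_n) is the element whose a-coordinate is
   f(coord_a(x_1), ..., coord_a(x_n)); it exists because lattice expressions in
   the coordinates approximate f (Stone-Weierstrass) and E is complete. The maps
   x |-> coord_a(x)^p carry the operations of E_(p) to those of the line, which
   gives the vector lattice axioms. Finally, if 0 < a <= |x| for an atom a and
   |x| <= v_1 (+) ... (+) v_n, then
   1 <= sum_i coord_a(v_i)^p <= sum_i |v_i|^p / |a|^p,
   so the seminorm of x is at least |a|^p > 0. *)
Require Import Defs.
From mathcomp Require Import all_boot all_order all_algebra.
From mathcomp Require Import all_classical all_reals all_analysis.
From mathcomp Require Import ring lra.
Set Implicit Arguments.
Unset Strict Implicit.
Unset Printing Implicit Defensive.
Import Order.TTheory GRing.Theory Num.Theory.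
Import numFieldNormedType.Exports.
Local Open Scope classical_set_scope.
Local Open Scope ring_scope.

(** * Lattice form of the Stone-Weierstrass theorem on a compact set *)

Section StoneLattice.
Variables (R : realType) (T : topologicalType) (K : set T).
Hypothesis cK : compact K.
Implicit Types (f g h : T -> R) (C G : set (T -> R)).

(** A Dini-type argument: by continuity a strict inequality [g x < h x] persists near [x], and it
    passes to all members of [C] below [g], so compactness yields one member that works on all of
    [K]. *)
Lemma compact_min_below C h :
  C !=set0 -> (forall g, C g -> continuous g) -> continuous h ->
  (forall f g, C f -> C g -> C (fun t => Num.min (f t) (g t))) ->
  (forall x, K x -> exists2 g, C g & g x < h x) ->
  exists2 g, C g & forall x, K x -> g x < h x.
Proof.
move=> [c0 Cc0] Ccont hcont Cmin Cbelow.
(* [F] is the filter of tails of the downward directed family [C]. *)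
pose F := filter_from C (fun g => [set g' | C g' /\ forall t, g' t <= g t]).
have FF : Filter F.
  apply: filter_from_filter; first by exists c0.
  move=> f g Cf Cg; exists (fun t => Num.min (f t) (g t)); first exact: Cmin.
  move=> k [Ck kle]; split; split=> // t.
    by apply: (le_trans (kle t)); rewrite ge_min lexx.
  by apply: (le_trans (kle t)); rewrite ge_min lexx orbT.
have /compact_near_coveringP/(_ _ F (fun g x => g x < h x) FF) := cK.
case=> [x Kx|g Cg gP].
  have [g Cg gx] := Cbelow x Kx.
  exists ([set x' | g x' < h x'], [set g' | C g' /\ forall t, g' t <= g t]).
    split; last by exists g.
    have cd : continuous (fun t => h t - g t).
      by move=> t; apply: cvgB; [exact: hcont | exact: Ccont].
    have : 0 < h x - g x by rewrite subr_gt0.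
    move=> /(cvgr_gt _ (cd x)).
    by apply: filterS => t; rewrite subr_gt0.
  move=> [x' g'] /= [gx' [_ g'le]].
  exact: le_lt_trans (g'le x') gx'.
by exists g => // x Kx; apply: (gP g) => //; split.
Qed.

(** Dual of [compact_min_below], obtained by negating [h] and the family. *)
Lemma compact_max_above C h :
  C !=set0 -> (forall g, C g -> continuous g) -> continuous h ->
  (forall f g, C f -> C g -> C (fun t => Num.max (f t) (g t))) ->
  (forall x, K x -> exists2 g, C g & h x < g x) ->
  exists2 g, C g & forall x, K x -> h x < g x.
Proof.
move=> [c0 Cc0] Ccont hcont Cmax Cabove.
have [||||x Kx|g Cg gh] :=
  @compact_min_below [set g | C (fun t => - g t)] (fun t => - h t).
- by exists (fun t => - c0 t); rewrite /=; under eq_fun do rewrite opprK.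
- move=> g /= /Ccont cg t; rewrite (_ : g = fun t => - - g t).
    by apply: cvgN; exact: cg.
  by apply/funext => s; rewrite opprK.
- by move=> t; apply: cvgN; exact: hcont.
- move=> f g /= Cf Cg; rewrite (_ : (fun _ => _) =
    fun t => Num.max (- f t) (- g t)); first exact: Cmax.
  by apply/funext => t; rewrite oppr_min.
- have [g Cg hg] := Cabove x Kx.
  exists (fun t => - g t); last by rewrite ltrN2.
  by rewrite /=; under eq_fun do rewrite opprK.
- by exists (fun t => - g t) => // x /gh; rewrite ltrNr.
Qed.

(** Compactness is used twice. For fixed [u], minima of interpolants fall below [f + e] on [K] while
    staying at least [f u] at [u]; maxima of these functions over [u] then rise above [f - e] and
    remain below [f + e]. *)
Lemma stone_weierstrass_lattice G f (e : R) :
  K !=set0 -> (forall g, G g -> continuous g) -> continuous f ->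
  (forall g h, G g -> G h -> G (fun t => Num.max (g t) (h t))) ->
  (forall g h, G g -> G h -> G (fun t => Num.min (g t) (h t))) ->
  (forall u v, K u -> K v -> exists g, [/\ G g, g u = f u & g v = f v]) ->
  0 < e -> exists2 g, G g & forall x, K x -> `|f x - g x| < e.
Proof.
move=> [x0 Kx0] Gcont fcont Gmax Gmin interp e0.
have sub_cont (d : R) : continuous (fun t => f t + d).
  by move=> t; apply: cvgD; [exact: fcont | exact: cvg_cst].
have below u : K u ->
    exists2 g, G g /\ f u <= g u & forall x, K x -> g x < f x + e.
  move=> Ku; apply: (@compact_min_below [set g | G g /\ f u <= g u]) => //.
  - by have [g [Gg gu _]] := interp _ _ Ku Ku; exists g; rewrite /= gu.
  - by move=> g [/Gcont].
  - move=> g h [Gg gu] [Gh hu]; split; first exact: Gmin.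
    by rewrite le_min gu hu.
  - move=> v Kv; have [g [Gg gu gv]] := interp _ _ Ku Kv.
    by exists g; [split; rewrite ?gu | rewrite gv ltrDl].
have [||||x Kx|g [Gg gle] gge] := @compact_max_above
  [set g | G g /\ forall x, K x -> g x < f x + e] (fun t => f t + - e).
- by have [g [Gg _] gle] := below _ Kx0; exists g.
- by move=> g [/Gcont].
- exact: sub_cont.
- move=> g h [Gg gle] [Gh hle]; split; first exact: Gmax.
  by move=> x Kx; rewrite gt_max gle ?hle.
- have [g [Gg gx] gle] := below _ Kx; exists g => //.
  by rewrite (lt_le_trans _ gx)// gtrDl oppr_lt0.
- exists g => // x Kx; rewrite ltr_norml.
  by have := gle _ Kx; have := gge _ Kx; lra.
Qed.

End StoneLattice.

(** * Continuous homogeneous functions and density of their sublattices *)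

Section HomogeneousFunctions.
Variables (R : realType) (n : nat).
Implicit Types (f g h : 'rV[R]_n -> R) (t u v : 'rV[R]_n).
Implicit Types (G : set ('rV[R]_n -> R)).
Local Notation HC := (@homogeneous_continuous R n).

(** The l1 norm is a lattice-linear expression in the coordinates, so it belongs to every
    homogeneous sublattice. *)
Definition taxicab t : R := \sum_(i < n) `|t ord0 i|.

Lemma taxicab_ge0 t : 0 <= taxicab t.
Proof. exact: sumr_ge0. Qed.

Lemma hc_coord i : HC (fun t => t ord0 i).
Proof.
split=> [t|a t _]; [exact: coord_continuous | by rewrite mxE].
Qed.

Lemma hc0 : HC (fun=> 0).
Proof. by split=> [|a t _]; [exact: cst_continuous | rewrite mulr0]. Qed.

Lemma hc_linear (a : R) f g : HC f -> HC g -> HC (fun t => a * f t + g t).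
Proof.
move=> [cf hf] [cg hg]; split=> [t|b t b0]; last first.
  by rewrite hf// hg// mulrDr mulrCA.
apply: (@continuousD _ _ _ (fun t => a * f t) g); last exact: cg.
by apply: continuousM; [exact: cst_continuous | exact: cf].
Qed.

Lemma hc_max f g : HC f -> HC g -> HC (fun t => Num.max (f t) (g t)).
Proof.
move=> [cf hf] [cg hg]; split=> [t|b t b0]; last first.
  by rewrite hf// hg// maxr_pMr.
by apply: continuous_max; [exact: cf | exact: cg].
Qed.

Lemma hc_eq0 f t : HC f -> taxicab t = 0 -> f t = 0.
Proof.
move=> [_ hf] /eqP; rewrite psumr_eq0// => /allP t0.
have -> : t = 0 *: t.
  apply/rowP => i; rewrite mxE mul0r; apply/eqP; rewrite -normr_eq0.
  by have := t0 i; rewrite mem_index_enum => /(_ isT).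
by rewrite hf// mul0r.
Qed.

(** Applied to three families: all continuous homogeneous functions, those with a value in the
    lattice, and those whose image under a given calculus has the expected coordinates. *)
Record homogeneous_sublattice G : Prop := HomogeneousSublattice {
  hs_hc : forall g, G g -> HC g;
  hs_coord : forall i, G (fun t => t ord0 i);
  hs0 : G (fun=> 0);
  hs_linear : forall a f g, G f -> G g -> G (fun t => a * f t + g t);
  hs_max : forall f g, G f -> G g -> G (fun t => Num.max (f t) (g t))
}.

Lemma homogeneous_sublattice_hc : homogeneous_sublattice HC.
Proof.
by split=> //; [exact: hc_coord|exact: hc0|exact: hc_linear|exact: hc_max].
Qed.

Section Closure.
Variables (G : set ('rV[R]_n -> R)) (sG : homogeneous_sublattice G).

Lemma hs_scale a f : G f -> G (fun t => a * f t).
Proof.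
move=> Gf; have := hs_linear sG a Gf (hs0 sG).
by under eq_fun do rewrite addr0.
Qed.

Lemma hs_add f g : G f -> G g -> G (fun t => f t + g t).
Proof.
move=> Gf Gg; have := hs_linear sG 1 Gf Gg.
by under eq_fun do rewrite mul1r.
Qed.

Lemma hs_opp f : G f -> G (fun t => - f t).
Proof.
by move=> /(hs_scale (-1)); under eq_fun do rewrite mulN1r.
Qed.

Lemma hs_min f g : G f -> G g -> G (fun t => Num.min (f t) (g t)).
Proof.
move=> /hs_opp Gf /hs_opp Gg; have := hs_opp (hs_max sG Gf Gg).
by under eq_fun do rewrite oppr_max !opprK.
Qed.

Lemma hs_norm f : G f -> G (fun t => `|f t|).
Proof.
move=> Gf; have := hs_max sG Gf (hs_opp Gf).
by under eq_fun do rewrite maxrN.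
Qed.

Lemma hs_sum (I : Type) (r : seq I) (F : I -> 'rV[R]_n -> R) :
  (forall i, G (F i)) -> G (fun t => \sum_(i <- r) F i t).
Proof.
move=> GF; elim: r => [|i r IH].
  by under eq_fun do rewrite big_nil; exact: hs0.
by under eq_fun do rewrite big_cons; exact: hs_add.
Qed.

Lemma hs_taxicab : G taxicab.
Proof. by apply: hs_sum => i; apply: hs_norm; exact: hs_coord. Qed.

End Closure.

Lemma hc_taxicab : HC taxicab.
Proof. exact: hs_taxicab homogeneous_sublattice_hc. Qed.

Lemma taxicab_sphere_compact : compact [set t | taxicab t = 1].
Proof.
apply: bounded_closed_compact.
  exists 1; split=> // M M1 t /= t1; rewrite (le_trans _ (ltW M1))//.
  rewrite /Num.norm/= mx_normrE.
  apply: bigmax_le => // -[i j] _ /=; rewrite -t1 ord1.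
  by rewrite /taxicab (bigD1 j)//= lerDl sumr_ge0.
apply: (@preimage_closed _ _ taxicab [set 1]); last exact: closed_eq.
by move=> t _; have [cm _] := hc_taxicab; exact: cm.
Qed.

(* On the sphere the norm is the constant 1, which is what the two-point
   interpolation needs besides a coordinate separating the points. *)
Lemma homogeneous_sublattice_dense G f (e : R) :
  homogeneous_sublattice G -> HC f -> 0 < e ->
  exists2 g, G g & forall t, `|f t - g t| <= e * taxicab t.
Proof.
move=> sG hf e0.
(* If the sphere is empty, as for [n = 0], every [t] has [taxicab t = 0], since otherwise it could
   be normalized; all homogeneous functions then vanish. *)
have [K0|] := pselect ([set t | taxicab t = 1] !=set0); last first.
  move=> K0; exists (fun=> 0) => [|t]; first exact: hs0.
  have [t0|t0] := eqVneq (taxicab t) 0.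
    by rewrite (hc_eq0 hf)// t0 mulr0 subrr normr0.
  exfalso; apply: K0; exists ((taxicab t)^-1 *: t) => /=.
  have [_ ->] := hc_taxicab.
    by rewrite mulVf.
  by rewrite invr_ge0 taxicab_ge0.
have [||||||g Gg gf] :=
  @stone_weierstrass_lattice R _ _ taxicab_sphere_compact G f e K0.
- by move=> g /(hs_hc sG)[].
- by case: hf.
- exact: hs_max.
- exact: hs_min.
- move=> u v /= u1 v1; have [<-|uv] := eqVneq u v.
    exists (fun t => f u * taxicab t); split; rewrite ?u1 ?mulr1//.
    by apply: hs_scale => //; exact: hs_taxicab.
  have [i uvi] : exists i, u ord0 i != v ord0 i.
    apply/existsP; apply: contra_neqT uv; rewrite negb_exists => /forallP uv.
    by apply/rowP => i; apply/eqP; rewrite -[_ == _]negbK uv.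
  (* Slope of the affine function of coordinate [i] taking the prescribed values; its constant term
     becomes a multiple of [taxicab]. *)
  pose b := (f u - f v) / (u ord0 i - v ord0 i).
  exists (fun t => b * t ord0 i + (f u - b * u ord0 i) * taxicab t); split.
  + apply: hs_linear => //; first exact: hs_coord.
    by apply: hs_scale => //; exact: hs_taxicab.
  + by rewrite u1; ring.
  + by rewrite v1 /b; field; rewrite subr_eq0.
- by [].
- exists g => // t; have [t0|t0] := eqVneq (taxicab t) 0.
    by rewrite (hc_eq0 hf)// (hc_eq0 (hs_hc sG Gg))// t0 mulr0 subrr normr0.
  have tp : 0 <= taxicab t by exact: taxicab_ge0.
  have -> : t = taxicab t *: ((taxicab t)^-1 *: t) by rewrite scalerA divff// scale1r.
  have [_ ->] := hf => //; have [_ ->] := hs_hc sG Gg => //.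
  have [_ hm] := hc_taxicab.
  rewrite -mulrBr normrM ger0_norm// hm// mulrCA ler_wpM2l//.
  rewrite hm ?invr_ge0// mulVf// mulr1 ltW// gf//=.
  by rewrite hm ?invr_ge0// mulVf.
Qed.

End HomogeneousFunctions.

(** * Elementary order and norm inequalities in Banach lattices *)

Section BanachLatticeTheory.
Variables (R : realType) (E : banachLatticeType R).
Implicit Types (x y z : E) (c : R).
Local Notation mod := (modulus (T := E) -%R).

Lemma leD2r z x y : (x + z <= y + z) = (x <= y).
Proof.
apply/idP/idP => xy; last exact: bl_leD2r.
by have := @bl_leD2r _ _ _ _ (- z) xy; rewrite !addrK.
Qed.

Lemma leBrD x y z : (x <= y - z) = (x + z <= y).
Proof. by rewrite -(leD2r z) subrK. Qed.

Lemma leBlD x y z : (x - y <= z) = (x <= z + y).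
Proof. by rewrite -(leD2r y (x - y)) subrK. Qed.

Lemma leN2 x y : (- x <= - y) = (y <= x).
Proof. by rewrite -(leD2r (x + y) (- x)) addKr addrCA addNr addr0. Qed.

Lemma leD x y z t : x <= y -> z <= t -> x + z <= y + t.
Proof.
by move=> xy zt; rewrite (@le_trans _ _ (y + z))// ?leD2r// ![y + _]addrC leD2r.
Qed.

Lemma leN0 x : (- x <= 0) = (0 <= x).
Proof. by rewrite -[in LHS]oppr0 leN2. Qed.

Lemma scale_ge0 c x : 0 <= c -> 0 <= x -> 0 <= c *: x.
Proof. exact: bl_scale_ge0. Qed.

Lemma scale_le c x y : 0 <= c -> x <= y -> c *: x <= c *: y.
Proof.
move=> c0 xy; rewrite -[c *: x]add0r -leBrD -scalerBr.
by apply: scale_ge0 => //; rewrite leBrD add0r.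
Qed.

Lemma scale_le2 c x y : 0 < c -> (c *: x <= c *: y) = (x <= y).
Proof.
move=> c0; apply/idP/idP; last by apply: scale_le; exact: ltW.
have c0' : 0 <= c^-1 by rewrite invr_ge0 ltW.
by move=> /(scale_le c0'); rewrite !scalerA mulVf ?gt_eqF// !scale1r.
Qed.

Lemma scale_lel c d x : 0 <= x -> c <= d -> c *: x <= d *: x.
Proof.
move=> x0 cd; rewrite -[c *: x]add0r -leBrD -scalerBl.
by apply: scale_ge0; rewrite ?subr_ge0.
Qed.

Lemma modulus_le x y : (mod x <= y) = (x <= y) && (- x <= y).
Proof. exact: leUx. Qed.

Lemma le_modulus x : x <= mod x.
Proof. exact: leUl. Qed.

Lemma leN_modulus x : - x <= mod x.
Proof. exact: leUr. Qed.

Lemma modulusN x : mod (- x) = mod x.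
Proof. by rewrite /modulus opprK joinC. Qed.

Lemma modulus_ge0 x : 0 <= mod x.
Proof.
have := leD (le_modulus x) (leN_modulus x); rewrite addrN.
move=> x2; have : (2 : R) *: (0 : E) <= (2 : R) *: mod x.
  by rewrite scaler0 scaler_nat.
by rewrite scale_le2.
Qed.

Lemma ger0_modulus x : 0 <= x -> mod x = x.
Proof.
move=> x0; apply/le_anti; rewrite le_modulus andbT modulus_le lexx/=.
by rewrite (le_trans _ x0)// leN0.
Qed.

Lemma modulusD x y : mod (x + y) <= mod x + mod y.
Proof.
by rewrite modulus_le opprD !leD ?le_modulus ?leN_modulus.
Qed.

Lemma modulusZ_le c x : mod (c *: x) <= `|c| *: mod x.
Proof.
wlog c0 : c x / 0 <= c => [wlg|].
  have [|c0] := leP 0 c; first exact: wlg.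
  have := wlg (- c) (- x); rewrite scaleNr scalerN opprK normrN modulusN.
  by apply; rewrite oppr_ge0 ltW.
rewrite ger0_norm// modulus_le scale_le ?le_modulus//=.
by rewrite -scalerN scale_le ?leN_modulus.
Qed.

Lemma modulusZ_ge0 c x : 0 <= x -> mod (c *: x) = `|c| *: x.
Proof.
move=> x0; wlog c0 : c / 0 <= c => [wlg|].
  have [|c0] := leP 0 c; first exact: wlg.
  rewrite -normrN -wlg ?oppr_ge0 ?ltW// scaleNr modulusN.
  by [].
by rewrite ger0_norm// ger0_modulus// scale_ge0.
Qed.

Lemma modulus_sub_le x y : mod (mod x - mod y) <= mod (x - y).
Proof.
have key u v : mod u - mod v <= mod (u - v).
  by rewrite -(leD2r (mod v)) subrK (le_trans _ (modulusD _ _))// subrK.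
rewrite modulus_le key opprB (le_trans (key _ _))//.
by rewrite -modulusN opprB.
Qed.

Lemma modulus_eq0 x : mod x <= 0 -> x = 0.
Proof.
rewrite modulus_le => /andP[x0 Nx0]; apply/le_anti; rewrite x0/=.
by rewrite -leN0.
Qed.

Lemma norm_le_modulus x y : mod x <= mod y -> `|x| <= `|y|.
Proof. exact: bl_norm_le. Qed.

Lemma norm_modulus x : `|mod x| = `|x|.
Proof.
have mm := ger0_modulus (modulus_ge0 x).
by apply/le_anti/andP; split; apply: norm_le_modulus; rewrite mm.
Qed.

Lemma norm_le x y : 0 <= x -> x <= y -> `|x| <= `|y|.
Proof.
move=> x0 xy; apply: norm_le_modulus.
by rewrite !ger0_modulus// (le_trans x0).
Qed.

Lemma half_double x : (2^-1 : R) *: (x + x) = x.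
Proof. by rewrite -mulr2n -[x *+ 2]scaler_nat scalerA mulVf ?pnatr_eq0// scale1r. Qed.

Lemma double_le x y : (x + x <= y + y) = (x <= y).
Proof. by rewrite -[in RHS](half_double x) -[in RHS](half_double y) scale_le2 ?invr_gt0. Qed.

(** Reduces joins to the modulus, so that a linear functional commuting with the modulus preserves
    joins. *)
Lemma joinE x y : Order.join x y = 2^-1 *: (x + y + mod (x - y)).
Proof.
have le2 z : (2^-1 *: (x + y + mod (x - y)) <= z) = (x <= z) && (y <= z).
  rewrite -[X in (_ <= X) = _]half_double scale_le2 ?invr_gt0// addrC -leBrD.
  rewrite modulus_le !leBrD opprB addrCA subrK.
  by rewrite [x + y]addrC addrCA subrK !double_le.
by apply/le_anti; rewrite leUx -le2 lexx le2 leUl leUr.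
Qed.

Lemma meetE x y : Order.meet x y = - Order.join (- x) (- y).
Proof.
apply/le_anti; apply/andP; split.
  by rewrite -leN2 opprK leUx !leN2 leIl leIr.
by rewrite lexI -[X in _ <= X]opprK -[X in _ && (_ <= X)]opprK !leN2 leUl leUr.
Qed.

(** The positive part of [x] lies below every [e *: y], so by monotonicity its norm is at most [e]
    times that of [y] for every [e > 0], hence zero. *)
Lemma archimedean x y :
  0 <= y -> (forall e, 0 < e -> x <= e *: y) -> x <= 0.
Proof.
move=> y0 xy; suff -> : 0 = Order.join x 0 by exact: leUl.
apply/esym/eqP; rewrite -normr_eq0 eq_le normr_ge0 andbT.
apply/ler_addgt0Pl => e e0; rewrite addr0.
have d0 : 0 < e / (`|y| + 1) by rewrite divr_gt0// ltr_wpDl.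
rewrite (le_trans (norm_le _ (_ : _ <= (e / (`|y| + 1)) *: y)))//.
- exact: leUr.
- by rewrite leUx xy// scale_ge0// ltW.
rewrite normrZ gtr0_norm// -mulrA ler_piMr ?(ltW e0)//.
by rewrite mulrC ler_pdivrMr ?ltr_wpDl// mul1r lerDl.
Qed.

End BanachLatticeTheory.

(** * Coordinate functionals of atoms *)

Section AtomCoordinates.
Variables (R : realType) (E : banachLatticeType R).
Implicit Types (a x y z : E) (c t s : R).
Local Notation mod := (modulus (T := E) -%R).

(** For [a >= 0] the meet is nonnegative anyway, so this inequality means that it equals 0. *)
Definition disjoint_from a x : Prop := Order.meet (mod x) a <= 0.

Lemma disjoint_le a x y :
  mod x <= mod y -> disjoint_from a y -> disjoint_from a x.
Proof. by move=> xy; apply: le_trans; rewrite lexI leIr andbT (le_trans _ xy)// leIl. Qed.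

(** Let [m] be the meet of [mod (x + y)] and [a]. Then [m - mod y] lies below [mod x] by the
    triangle inequality and below [a], hence below 0; so [m] lies below both [mod y] and [a]. *)
Lemma disjointD a x y :
  disjoint_from a x -> disjoint_from a y -> disjoint_from a (x + y).
Proof.
move=> xa ya; apply: le_trans ya; rewrite lexI leIr andbT.
rewrite -[X in _ <= X]add0r -leBlD; apply: le_trans xa; rewrite lexI !leBlD.
rewrite (le_trans (leIl _ _) (modulusD _ _))/=.
by rewrite (le_trans (leIr _ _))// -[X in X <= _]addr0 leD// modulus_ge0.
Qed.

Lemma disjointZ a c x : 0 <= a -> disjoint_from a x -> disjoint_from a (c *: x).
Proof.
(* As [d] is at least 1 and at least [|c|], the meet divided by [d] lies below both [mod x] and
   [a]. *)
move=> a0 xa; pose d := Num.max 1 `|c|.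
have d0 : 0 < d by rewrite lt_max ltr01.
rewrite /disjoint_from -[_ <= _](scale_le2 _ _ (_ : 0 < d^-1)) ?invr_gt0// scaler0.
apply: le_trans xa; rewrite lexI; apply/andP; split.
  rewrite -(scale_le2 _ _ d0) scalerA divff ?gt_eqF// scale1r.
  rewrite (le_trans (leIl _ _))// (le_trans (modulusZ_le _ _))//.
  by rewrite scale_lel ?modulus_ge0// le_max lexx orbT.
rewrite -(scale_le2 _ _ d0) scalerA divff ?gt_eqF// scale1r.
rewrite (le_trans (leIr _ _))// -[X in X <= _]scale1r scale_lel//.
by rewrite le_max lexx.
Qed.

Lemma disjointN a x : disjoint_from a x -> disjoint_from a (- x).
Proof. by rewrite /disjoint_from modulusN. Qed.

Definition is_coord a x t : Prop := disjoint_from a (x - t *: a).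

(** Subtraction makes [(s - t) *: a] disjoint from [a], yet the multiple of [a] by the minimum of
    [|s - t|] and 1 lies below both its modulus and [a]. As [a > 0], this minimum cannot be
    positive. *)
Lemma is_coord_uniq a x t s :
  0 < a -> is_coord a x t -> is_coord a x s -> t = s.
Proof.
move=> a0 xt /disjointN xs; have a0' := ltW a0.
have := disjointD xt xs; rewrite addrC opprB addrA subrK -scalerBl.
rewrite /disjoint_from modulusZ_ge0// => st0; apply/esym/eqP; rewrite -subr_eq0.
apply/negPn/negP => st; have d0 : 0 < Num.min `|s - t| 1.
  by rewrite lt_min normr_gt0 st/=.
have : Num.min `|s - t| 1 *: a <= Num.min `|s - t| 1 *: 0.
  rewrite scaler0; apply: le_trans st0; rewrite lexI; apply/andP; split.
    by rewrite scale_lel// ge_min lexx.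
  by rewrite -[X in _ <= X]scale1r scale_lel// ge_min lexx orbT.
by rewrite scale_le2// => /(lt_le_trans a0); rewrite ltxx.
Qed.

Lemma is_coordD a x y t s :
  is_coord a x t -> is_coord a y s -> is_coord a (x + y) (t + s).
Proof.
by move=> xt ys; rewrite /is_coord scalerDl opprD addrACA; exact: disjointD.
Qed.

Lemma is_coordZ a c x t :
  0 <= a -> is_coord a x t -> is_coord a (c *: x) (c * t).
Proof.
by move=> a0 xt; rewrite /is_coord -scalerA -scalerBr; exact: disjointZ.
Qed.

(** By the reverse triangle inequality the new remainder is dominated in modulus by the old one. *)
Lemma is_coord_modulus a x t :
  0 <= a -> is_coord a x t -> is_coord a (mod x) `|t|.
Proof.
move=> a0; apply: disjoint_le.
by rewrite -(modulusZ_ge0 t a0); exact: modulus_sub_le.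
Qed.

(** The coordinate is the largest [t] with [t *: a <= x]: the norm bounds such [t], and the
    Archimedean property shows that the supremum is attained. The meet of the remainder with [a] is
    a multiple [r *: a] of the atom, and [r > 0] would allow a larger [t]. *)
Lemma ge0_coord_exists a x : atom a -> 0 <= x ->
  exists t, [/\ is_coord a x t, 0 <= t & t *: a <= x].
Proof.
move=> [a0 ata] x0; have a0' := ltW a0.
have na : 0 < `|a| by rewrite normr_gt0 gt_eqF.
pose A := [set t | 0 <= t /\ t *: a <= x].
have A0 : A 0 by split; rewrite // scale0r.
have supA : has_sup A.
  split; first by exists 0.
  exists (`|x| / `|a|) => t [t0 tx]; rewrite ler_pdivlMr//.
  rewrite -[t]ger0_norm// -normrZ; apply: norm_le => //.
  exact: scale_ge0.
have s0 : 0 <= sup A by apply: ub_le_sup => //; case: supA.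
have sx : sup A *: a <= x.
  rewrite -[X in _ <= X]add0r -leBlD.
  apply: (archimedean a0') => e e0.
  have [t [t0 tx] te] := sup_adherent e0 supA.
  rewrite (le_trans (_ : _ <= sup A *: a - t *: a))//.
    by rewrite ![sup A *: a + _]addrC leD2r leN2.
  by rewrite -scalerBl scale_lel//; move: te; lra.
exists (sup A); split=> //; rewrite /is_coord /disjoint_from.
rewrite ger0_modulus; last by rewrite leBrD add0r.
have m0 : 0 <= Order.meet (x - sup A *: a) a by rewrite lexI leBrD add0r sx.
have [r rE] := ata _ m0 (leIr _ _).
rewrite rE; have [r0|r0] := leP r 0.
  by rewrite -(scale0r a) scale_lel.
have : A (r + sup A).
  split; first by rewrite addr_ge0// ltW.
  by rewrite scalerDl -leBrD -rE leIl.
move/(ub_le_sup supA.2); rewrite -subr_ge0 opprD addrCA subrr addr0.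
by rewrite oppr_ge0 leNgt r0.
Qed.

(** Follows from the positive case, as [x] is the difference of the positive elements [mod x] and
    [mod x - x]. *)
Lemma coord_exists a x : atom a -> exists t, is_coord a x t.
Proof.
move=> ata; have a0 := ltW ata.1.
have [t [xt _ _]] := ge0_coord_exists ata (modulus_ge0 x).
have d0 : 0 <= mod x - x by rewrite leBrD add0r le_modulus.
have [s [ys _ _]] := ge0_coord_exists ata d0.
exists (t + -1 * s); rewrite -[x](subKr (mod x)) -[- (_ - _)]scaleN1r.
by apply: is_coordD => //; exact: is_coordZ.
Qed.

Definition coord a x : R := xget 0 [set t | is_coord a x t].

Section Atom.
Variables (a : E) (ata : atom a).
Let a_gt0 : 0 < a := ata.1.
Let a_ge0 : 0 <= a := ltW a_gt0.

Lemma coordP x : is_coord a x (coord a x).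
Proof.
by have [t xt] := coord_exists x ata; rewrite /coord; case: xgetP => [s _|/(_ t)].
Qed.

Lemma coord_eq x t : is_coord a x t -> coord a x = t.
Proof. exact: is_coord_uniq (coordP x). Qed.

Lemma coordD x y : coord a (x + y) = coord a x + coord a y.
Proof. by apply: coord_eq; apply: is_coordD; exact: coordP. Qed.

Lemma coordZ c x : coord a (c *: x) = c * coord a x.
Proof. by apply: coord_eq; apply: is_coordZ => //; exact: coordP. Qed.

Lemma coordN x : coord a (- x) = - coord a x.
Proof. by rewrite -scaleN1r coordZ mulN1r. Qed.

Lemma coord0 : coord a 0 = 0.
Proof. by rewrite -(scale0r 0) coordZ mul0r. Qed.

Lemma coord_modulus x : coord a (mod x) = `|coord a x|.
Proof. by apply: coord_eq; apply: is_coord_modulus => //; exact: coordP. Qed.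

Lemma coord_join x y : coord a (Order.join x y) = Num.max (coord a x) (coord a y).
Proof.
rewrite joinE coordZ !coordD coord_modulus coordD coordN.
by rewrite maxr_absE mulrC.
Qed.

Lemma coord_meet x y : coord a (Order.meet x y) = Num.min (coord a x) (coord a y).
Proof. by rewrite meetE coordN coord_join !coordN oppr_max !opprK. Qed.

Lemma coord_atom : coord a a = 1.
Proof.
apply: coord_eq; rewrite /is_coord scale1r subrr /disjoint_from.
by rewrite ger0_modulus// leIl.
Qed.

Lemma coord_le x y : x <= y -> coord a x <= coord a y.
Proof.
move=> xy; have -> : y = Order.join x y.
  by apply/le_anti; rewrite leUr leUx xy lexx.
by rewrite coord_join le_max lexx.
Qed.

(** The construction for positive elements gives [coord a (mod x) *: a <= mod x], and the norm is
    monotone. *)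
Lemma coord_norm_le x : `|coord a x| * `|a| <= `|x|.
Proof.
have [t [/coord_eq xt t0 ta]] := ge0_coord_exists ata (modulus_ge0 x).
rewrite -(norm_modulus x) -coord_modulus xt -[t]ger0_norm// -normrZ.
by apply: norm_le => //; exact: scale_ge0.
Qed.

End Atom.

Hypothesis dE : discrete_lattice E.

(** Were the positive part of [x - y] nonzero, it would dominate an atom [a] and have [a]-coordinate
    at least 1; the hypothesis makes that coordinate 0. *)
Lemma le_coordP x y : (forall a, atom a -> coord a x <= coord a y) -> x <= y.
Proof.
move=> xy; rewrite -[y]add0r -leBlD.
have [p0|p0] := eqVneq (Order.join (x - y) 0) 0; first by rewrite -[X in _ <= X]p0 leUl.
have [a [ata ale]] : exists a, atom a /\ a <= Order.join (x - y) 0.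
  by apply: dE; rewrite lt_def p0 leUr.
have := coord_le ata ale; rewrite coord_atom// coord_join// coord0//.
rewrite coordD// coordN// max_r; last by rewrite subr_le0 xy.
by rewrite ler10.
Qed.

Lemma eq_coord x y : (forall a, atom a -> coord a x = coord a y) -> x = y.
Proof.
by move=> xy; apply/le_anti/andP; split; apply: le_coordP => a /xy ->.
Qed.

End AtomCoordinates.

(** * Existence and uniqueness of the functional calculus on discrete Banach lattices *)

Section DiscreteFunctionalCalculus.
Variables (R : realType) (E : banachLatticeType R).
Hypothesis dE : discrete_lattice E.
Variables (n : nat) (x : n.-tuple E).
Implicit Types (a z w : E) (f g : 'rV[R]_n -> R).
Local Notation HC := (@homogeneous_continuous R n).

Definition coords a : 'rV[R]_n := \row_i coord a (tnth x i).

Definition evaluates_to f z : Prop :=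
  forall a, atom a -> coord a z = f (coords a).

Lemma evaluates_to_uniq f z w : evaluates_to f z -> evaluates_to f w -> z = w.
Proof.
by move=> fz fw; apply: (eq_coord dE) => a ata; rewrite fz// fw.
Qed.

Lemma evaluates_to_linear c f g z w : evaluates_to f z -> evaluates_to g w ->
  evaluates_to (fun t => c * f t + g t) (c *: z + w).
Proof. by move=> fz gw a ata; rewrite coordD// coordZ// fz// gw. Qed.

Lemma evaluates_to_max f g z w : evaluates_to f z -> evaluates_to g w ->
  evaluates_to (fun t => Num.max (f t) (g t)) (Order.join z w).
Proof. by move=> fz gw a ata; rewrite coord_join// fz// gw. Qed.

Lemma evaluates_to_min f g z w : evaluates_to f z -> evaluates_to g w ->
  evaluates_to (fun t => Num.min (f t) (g t)) (Order.meet z w).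
Proof. by move=> fz gw a ata; rewrite coord_meet// fz// gw. Qed.

Lemma evaluates_to_coord i : evaluates_to (fun t => t ord0 i) (tnth x i).
Proof. by move=> a ata; rewrite mxE. Qed.

Lemma evaluates_to0 : evaluates_to (fun=> 0) 0.
Proof. by move=> a ata; rewrite coord0. Qed.

Lemma evaluable_sublattice :
  homogeneous_sublattice [set f | HC f /\ exists z, evaluates_to f z].
Proof.
split=> [g []//|i||c f g [hf [z fz]] [hg [w gw]]|f g [hf [z fz]] [hg [w gw]]].
- by split; [exact: hc_coord | exists (tnth x i); exact: evaluates_to_coord].
- by split; [exact: hc0 | exists 0; exact: evaluates_to0].
- split; first exact: hc_linear.
  by exists (c *: z + w); exact: evaluates_to_linear.
- split; first exact: hc_max.
  by exists (Order.join z w); exact: evaluates_to_max.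
Qed.

(** Two elements of [B e] differ in modulus by at most [2e] times the value [X] of [taxicab], so the
    sets [B e] generate a Cauchy filter. Its limit has the right coordinates because coordinates are
    norm-continuous. *)
Lemma evaluable f : HC f -> exists z, evaluates_to f z.
Proof.
move=> hf; pose B (e : R) : set E := [set z | forall a, atom a ->
  `|f (coords a) - coord a z| <= e * taxicab (coords a)].
have [X evX] : exists X, evaluates_to (@taxicab R n) X.
  by have [_] := hs_taxicab evaluable_sublattice.
have B0 e : 0 < e -> exists z, B e z.
  move=> /(homogeneous_sublattice_dense evaluable_sublattice hf).
  move=> [g [hg [z gz]] fg].
  by exists z => a ata; rewrite gz.
have Bdist e z w : 0 < e -> B e z -> B e w -> `|z - w| <= (e + e) * `|X|.
  move=> e0 Bz Bw; have ee : 0 <= e + e by rewrite addr_ge0// ltW.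
  rewrite -[e + e]ger0_norm// -normrZ.
  apply: norm_le_modulus; apply: (le_coordP dE) => a ata.
  rewrite !coord_modulus// coordZ// evX// coordD// coordN//.
  rewrite [leRHS]ger0_norm ?mulr_ge0 ?taxicab_ge0//.
  rewrite mulrDl (le_trans _ (lerD (Bz _ ata) (Bw _ ata)))//.
  rewrite [in leRHS]distrC (le_trans _ (ler_normD _ _))//.
  by rewrite addrA subrK.
pose F := filter_from [set e : R | 0 < e] B.
have FF : ProperFilter F.
  apply: filter_from_proper; last by move=> e /B0.
  apply: filter_from_filter; first by exists 1 => /=.
  move=> e d /= e0 d0; exists (Num.min e d); first by rewrite /= lt_min e0.
  move=> z Bz; split=> a ata; apply: (le_trans (Bz a ata));
    by rewrite ler_wpM2r ?taxicab_ge0// ge_min lexx ?orbT.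
have Fcauchy : cauchy F.
  apply/cauchy_ballP => e e0.
  (* With this radius the distance bound [(d + d) * |X|] is below [e / 2]; the [+ 1] covers the case
     [X = 0]. *)
  have d0 : 0 < e / (`|X| + 1) / 4 by rewrite !divr_gt0// ltr_wpDl.
  exists (B (e / (`|X| + 1) / 4), B (e / (`|X| + 1) / 4)).
    by split; exists (e / (`|X| + 1) / 4).
  move=> [z w] [/= Bz Bw]; rewrite -ball_normE /ball_/=.
  apply: (le_lt_trans (Bdist _ _ _ d0 Bz Bw)).
  have X1 : 0 < `|X| + 1 by rewrite ltr_wpDl.
  have -> : (e / (`|X| + 1) / 4 + e / (`|X| + 1) / 4) * `|X| =
    e * ((`|X| / (`|X| + 1)) / 2) by field; rewrite gt_eqF.
  rewrite gtr_pMr// ltr_pdivrMr// mul1r ltr_pdivrMr//.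
  by have := normr_ge0 X; lra.
have /cvg_ex[z Fz] := @cauchy_cvg E F FF Fcauchy.
exists z => a ata; apply/eqP; rewrite -subr_eq0 -normr_eq0 eq_le normr_ge0 andbT.
have na : 0 < `|a| by rewrite normr_gt0 gt_eqF// ata.1.
apply/ler_addgt0Pl => e e0; rewrite addr0.
(* Splits [e] into [d], for passing from the limit to a nearby [w], and [d * taxicab (coords a)],
   for [w] lying in [B d]. *)
pose d := e / (1 + taxicab (coords a)).
have t1 : 0 < 1 + taxicab (coords a) by rewrite ltr_pwDl// taxicab_ge0.
have d0 : 0 < d by rewrite divr_gt0.
have /filter_ex[w [zw Bw]] : F ([set w | `|z - w| < d * `|a|] `&` B d).
  apply: filterI; last by exists d.
  by apply: (@cvgr_dist_lt _ _ _ F _ id z Fz); rewrite mulr_gt0.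
have zwa : `|coord a z - coord a w| <= d.
  rewrite -coordN// -coordD// -(ler_pM2r na).
  by rewrite (le_trans (coord_norm_le ata _))// ltW.
have -> : e = d + d * taxicab (coords a).
  by rewrite -[X in X + _]mulr1 -mulrDr divfK// gt_eqF.
rewrite (le_trans _ (lerD zwa (Bw _ ata)))//.
by rewrite [`|f _ - _|]distrC (le_trans _ (ler_normD _ _))// addrA subrK.
Qed.

Section Uniqueness.
Variable tau : ('rV[R]_n -> R) -> E.
Hypothesis ftau : is_functional_calculus x tau.

Lemma functional_calculus_sublattice :
  homogeneous_sublattice [set f | HC f /\ evaluates_to f (tau f)].
Proof.
split=> [g []//|i||c f g [hf ef] [hg eg]|f g [hf ef] [hg eg]].
- split; first exact: hc_coord.
  by rewrite (fc_coord ftau); exact: evaluates_to_coord.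
- split; first exact: hc0.
  (* Writing the zero function as [-1 * 0 + 0] gives [tau 0 = - tau 0 + tau 0], which is 0. *)
  have := fc_linear ftau (-1) (hc0 R n) (hc0 R n).
  under eq_fun do rewrite mulr0 addr0.
  by rewrite scaleN1r addNr => ->; exact: evaluates_to0.
- split; first exact: hc_linear.
  by rewrite (fc_linear ftau)//; exact: evaluates_to_linear.
- split; first exact: hc_max.
  by rewrite (fc_join ftau)//; exact: evaluates_to_max.
Qed.

Lemma functional_calculus_le f g :
  HC f -> HC g -> (forall t, f t <= g t) -> tau f <= tau g.
Proof.
move=> hf hg fg; have := fc_meet ftau hf hg.
under eq_fun do rewrite min_l//.
by move=> ->; exact: leIr.
Qed.

(** A calculus is monotone, so [tau f] is squeezed between the images of [g - d * taxicab] and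
    [g + d * taxicab], whose coordinates are known, for [g] in a dense sublattice. Hence all calculi
    agree on continuous homogeneous functions. *)
Lemma functional_calculus_evaluates f : HC f -> evaluates_to f (tau f).
Proof.
move=> hf a ata; apply/eqP; rewrite -subr_eq0 -normr_eq0 eq_le normr_ge0 andbT.
have sG := functional_calculus_sublattice.
apply/ler_addgt0Pl => e e0; rewrite addr0.
(* Halved because [coord a (tau f)] and [f (coords a)] are each within [d * taxicab (coords a)] of
   [g (coords a)]. *)
pose d := e / (1 + taxicab (coords a)) / 2.
have t1 : 0 < 1 + taxicab (coords a) by rewrite ltr_pwDl// taxicab_ge0.
have d0 : 0 < d by rewrite !divr_gt0.
have [g [hg eg] fg] := homogeneous_sublattice_dense sG hf d0.
have [hT eT] := hs_taxicab sG.
have above : coord a (tau f) <= d * taxicab (coords a) + g (coords a).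
  rewrite -eg// -eT// -coordZ// -coordD// -(fc_linear ftau)//.
  apply: coord_le => //; apply: functional_calculus_le => //.
    exact: hc_linear.
  by move=> t; have := fg t; rewrite ler_norml => /andP[_]; lra.
have below : (- d) * taxicab (coords a) + g (coords a) <= coord a (tau f).
  rewrite -eg// -eT// -coordZ// -coordD// -(fc_linear ftau)//.
  apply: coord_le => //; apply: functional_calculus_le => //.
    exact: hc_linear.
  by move=> t; have := fg t; rewrite ler_norml => /andP[+ _]; lra.
have := fg (coords a); rewrite !ler_norml => /andP[lo hi].
have -> : e = d * taxicab (coords a) + d * taxicab (coords a) + d + d.
  by rewrite /d; field; rewrite gt_eqF.
by move: above below lo hi d0; rewrite mulNr; lra.
Qed.

End Uniqueness.

(** [tau] picks the element with the prescribed coordinates; each law holds because both sides have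
    the same coordinates. *)
Lemma functional_calculus_exists : exists tau, is_functional_calculus x tau.
Proof.
pose tau f := xget 0 [set z | evaluates_to f z].
have tauP f : HC f -> evaluates_to f (tau f).
  by move=> /evaluable[z fz]; rewrite /tau; case: xgetP => [w _|/(_ z)].
exists tau; split=> [c f g hf hg|f g hf hg|f g hf hg|i].
- apply: (evaluates_to_uniq (tauP _ (hc_linear c hf hg))).
  by apply: evaluates_to_linear; exact: tauP.
- apply: (evaluates_to_uniq (tauP _ (hc_max hf hg))).
  by apply: evaluates_to_max; exact: tauP.
- have hm := hs_min (homogeneous_sublattice_hc R n) hf hg.
  apply: (evaluates_to_uniq (tauP _ hm)).
  by apply: evaluates_to_min; exact: tauP.
- exact: evaluates_to_uniq (tauP _ (hc_coord R i)) (evaluates_to_coord i).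
Qed.

Lemma coord_fcalc f a : HC f -> atom a -> coord a (fcalc x f) = f (coords a).
Proof.
move=> hf; have [tau ftau] := functional_calculus_exists.
rewrite /fcalc; case: xgetP => [_ _ [tau' ftau' ->]|/(_ (tau f))]; last first.
  by case; exists tau.
by move: a; exact: functional_calculus_evaluates.
Qed.

End DiscreteFunctionalCalculus.

(** * Signed powers as order automorphisms of the real line *)

Section SignedPower.
Variable R : realType.
Implicit Types s t p : R.

Lemma ger0_spow t p : 0 < p -> 0 <= t -> spow t p = t `^ p.
Proof.
move=> p0; rewrite le_eqVlt => /predU1P[<-|t0].
  by rewrite /spow sgr0 mulr0 powR0// gt_eqF.
by rewrite /spow gtr0_norm// gtr0_sg// mulr1.
Qed.

Lemma spow0 p : spow 0 p = 0 :> R.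
Proof. by rewrite /spow sgr0 mulr0. Qed.

Lemma spow1 p : spow 1 p = 1 :> R.
Proof. by rewrite /spow normr1 sgr1 powR1 mulr1. Qed.

Lemma spowN t p : spow (- t) p = - spow t p.
Proof. by rewrite /spow normrN sgrN mulrN. Qed.

Lemma spowM s t p : spow (s * t) p = spow s p * spow t p.
Proof. by rewrite /spow normrM powRM// sgrM mulrACA. Qed.

Lemma sgr_spow t p : Num.sg (spow t p) = Num.sg t.
Proof.
have [->|t0] := eqVneq t 0; first by rewrite spow0.
by rewrite /spow sgrM sgr_id gtr0_sg ?mul1r// powR_gt0 ?normr_gt0.
Qed.

Lemma normr_spow t p : 0 < p -> `|spow t p| = spow `|t| p.
Proof.
move=> p0; have [->|t0] := eqVneq t 0; first by rewrite normr0 spow0 normr0.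
by rewrite /spow normrM normr_sg t0 normr_id sgr_norm t0 !mulr1 ger0_norm ?powR_ge0.
Qed.

Lemma spowK p : 0 < p -> cancel (fun t => spow t p) (fun t => spow t p^-1).
Proof.
move=> p0 t; rewrite {1}/spow normr_spow// ger0_spow// -powRrM.
by rewrite divff ?gt_eqF// powRr1// sgr_spow mulrC -numEsg.
Qed.

Lemma spowVK p : 0 < p -> cancel (fun t => spow t p^-1) (fun t => spow t p).
Proof. by move=> p0; rewrite -{2}[p]invrK; apply: spowK; rewrite invr_gt0. Qed.

Lemma spow_le p s t : 0 < p -> (spow s p <= spow t p) = (s <= t).
Proof.
move=> p0; apply: (@le_mono _ _ _ _ (fun t => spow t p)) => {}s {}t st.
have pos u : 0 < u -> 0 < spow u p by move=> u0; rewrite ger0_spow ?powR_gt0 ?ltW.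
have [t0|t0] := leP t 0.
  rewrite -ltrN2 -!spowN !ger0_spow ?oppr_ge0 ?(ltW (lt_le_trans st t0))//.
  by rewrite gt0_ltr_powR ?nnegrE ?oppr_ge0 ?ltrN2// ltW// (lt_le_trans st).
have [s0|s0] := leP s 0; last first.
  by rewrite !ger0_spow ?ltW// gt0_ltr_powR ?nnegrE ?ltW.
apply: le_lt_trans (pos _ t0); rewrite -oppr_ge0 -spowN.
by rewrite ger0_spow ?oppr_ge0// powR_ge0.
Qed.

Lemma spow_lt p s t : 0 < p -> (spow s p < spow t p) = (s < t).
Proof. by move=> p0; rewrite !ltNge spow_le. Qed.

Lemma spow_ge0 t p : 0 < p -> (0 <= spow t p) = (0 <= t).
Proof. by move=> p0; rewrite -{1}(spow0 p) spow_le. Qed.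

(* An order isomorphism of the line is continuous for the order topology. *)
Lemma continuous_spow p : 0 < p -> continuous (fun t => spow t p).
Proof.
move=> p0 t; apply/cvgrPdist_lt => e e0.
have gtE u v : (u < spow v p) = (spow u p^-1 < v).
  by rewrite -[in LHS](spowVK p0 u) spow_lt.
have ltE u v : (spow v p < u) = (v < spow u p^-1).
  by rewrite -[in LHS](spowVK p0 u) spow_lt.
have lo : spow (spow t p - e) p^-1 < t by rewrite -gtE gtrBl.
have hi : t < spow (spow t p + e) p^-1 by rewrite -ltE ltrDl.
near=> s; rewrite distrC ltr_distl; apply/andP; split.
  by rewrite gtE; near: s; exact: lt_nbhsr.
by rewrite ltE; near: s; exact: lt_nbhsl.
Unshelve. all: by end_near. Qed.

End SignedPower.

(** * The concavification of a discrete Banach lattice and its norm *)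

Section Concavification.
Variables (R : realType) (E : banachLatticeType R) (p : R).
Hypotheses (dE : discrete_lattice E) (p_gt0 : 0 < p).
Implicit Types (a x y z v w : E) (vs : seq E) (c : R).
Local Notation mod := (modulus (T := E) -%R).
Local Notation conc_add := (@conc_add R E p).
Local Notation conc_scale := (@conc_scale R E p).
Local Notation conc_norm := (@conc_norm R E p).
Let pV_gt0 : 0 < p^-1. Proof. by rewrite invr_gt0. Qed.

(** Makes [coord_fcalc] applicable to [conc_add]. A scalar leaves the inner sum as its signed [p]-th
    power, and the outer root restores it. *)
Lemma hc_conc_add : @homogeneous_continuous R 2
  (fun t => spow (spow (t ord0 ord0) p + spow (t ord0 ord_max) p) p^-1).
Proof.
split=> [t|c t c0]; last first.
  by rewrite !mxE !spowM -mulrDr spowM spowK.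
have cs i : {for t, continuous (fun u : 'rV[R]_2 => spow (u ord0 i) p)}.
  apply: (@continuous_comp _ _ _ (fun u : 'rV[R]_2 => u ord0 i) (fun s => spow s p)).
    exact: coord_continuous.
  exact: continuous_spow.
apply: (@continuous_comp _ _ _
  (fun t : 'rV[R]_2 => spow (t ord0 ord0) p + spow (t ord0 ord_max) p)
  (fun s => spow s p^-1)); last exact: continuous_spow.
by apply: continuousD; exact: cs.
Qed.

Definition lcoord a x : R := spow (coord a x) p.

Section Atom.
Variables (a : E) (ata : atom a).

Lemma lcoord_add x y : lcoord a (conc_add x y) = lcoord a x + lcoord a y.
Proof.
rewrite /lcoord /conc_add (coord_fcalc dE _ hc_conc_add)// !mxE.
by rewrite spowVK.
Qed.

Lemma lcoord_scale c x : lcoord a (conc_scale c x) = c * lcoord a x.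
Proof. by rewrite /lcoord coordZ// spowM spowVK. Qed.

Lemma lcoord0 : lcoord a 0 = 0.
Proof. by rewrite /lcoord coord0// spow0. Qed.

Lemma lcoord_modulus x : lcoord a (mod x) = `|lcoord a x|.
Proof. by rewrite /lcoord coord_modulus// normr_spow. Qed.

Lemma lcoord_le x y : x <= y -> lcoord a x <= lcoord a y.
Proof. by move=> xy; rewrite spow_le// coord_le. Qed.

Lemma lcoord_sum v vs :
  lcoord a (foldl conc_add v vs) = \sum_(w <- v :: vs) lcoord a w.
Proof.
elim: vs v => [|w vs IH] v /=; first by rewrite big_seq1.
by rewrite IH !big_cons lcoord_add addrA.
Qed.

Lemma lcoord_norm_le x : 0 <= x -> lcoord a x * `|a| `^ p <= `|x| `^ p.
Proof.
move=> x0; have cx0 : 0 <= coord a x by rewrite -(coord0 ata) coord_le.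
rewrite /lcoord ger0_spow// -powRM//.
apply: ge0_ler_powR; rewrite ?nnegrE ?mulr_ge0// ?(ltW p_gt0)//.
by rewrite -[coord a x]ger0_norm// coord_norm_le.
Qed.

End Atom.

Lemma le_lcoordP x y : (forall a, atom a -> lcoord a x <= lcoord a y) -> x <= y.
Proof.
by move=> xy; apply: (le_coordP dE) => a /xy; rewrite spow_le.
Qed.

Lemma eq_lcoord x y : (forall a, atom a -> lcoord a x = lcoord a y) -> x = y.
Proof.
by move=> xy; apply/le_anti/andP; split; apply: le_lcoordP => a /xy ->.
Qed.

Lemma conc_scaleN1 x : conc_scale (-1) x = - x.
Proof. by rewrite /conc_scale spowN spow1 scaleN1r. Qed.

Lemma modulus_conc x : modulus (conc_scale (-1)) x = mod x.
Proof. by rewrite /modulus conc_scaleN1. Qed.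

Lemma conc_vector_lattice : @is_vector_lattice R E 0 conc_add conc_scale.
Proof.
split.
- move=> x y z; apply: eq_lcoord => a ata.
  by rewrite !lcoord_add// addrA.
- by move=> x y; apply: eq_lcoord => a ata; rewrite !lcoord_add// addrC.
- by move=> x; apply: eq_lcoord => a ata; rewrite lcoord_add// lcoord0// add0r.
- move=> x; apply: eq_lcoord => a ata.
  by rewrite lcoord_add// lcoord_scale// lcoord0// mulN1r addNr.
- by move=> c d x; apply: eq_lcoord => a ata; rewrite !lcoord_scale// mulrA.
- by move=> x; rewrite /conc_scale spow1 scale1r.
- move=> c x y; apply: eq_lcoord => a ata.
  by rewrite lcoord_scale// !lcoord_add// !lcoord_scale// mulrDr.
- move=> c d x; apply: eq_lcoord => a ata.
  by rewrite lcoord_add// !lcoord_scale// mulrDl.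
- move=> x y z xy; apply: le_lcoordP => a ata.
  by rewrite !lcoord_add// lerD2r lcoord_le.
- by move=> c x c0 x0; apply: scale_ge0 => //; rewrite spow_ge0.
Qed.

(** Names the set whose infimum is [conc_norm x], so that operations on coverings can be stated
    separately. *)
Definition covering_cost x : set R :=
  [set s : R | exists (v : E) (vs : seq E),
    [/\ all (fun w => 0 <= w) (v :: vs),
        mod x <= foldl conc_add v vs
      & s = \sum_(w <- v :: vs) `|w| `^ p]].

Lemma covering_cost_ge0 x s : covering_cost x s -> 0 <= s.
Proof. by move=> [v [vs [_ _ ->]]]; apply: sumr_ge0 => w _; exact: powR_ge0. Qed.

Lemma covering_cost_modulus x : covering_cost x (`|mod x| `^ p).
Proof. by exists (mod x), [::]; rewrite /= modulus_ge0 big_seq1. Qed.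

Lemma covering_cost_has_inf x : has_inf (covering_cost x).
Proof.
split; first by exists (`|mod x| `^ p); exact: covering_cost_modulus.
by exists 0 => s /covering_cost_ge0.
Qed.

Lemma conc_norm_le x s : covering_cost x s -> conc_norm x <= s.
Proof. by apply: ge_inf; exact: (covering_cost_has_inf x).2. Qed.

Lemma le_conc_norm x b :
  (forall s, covering_cost x s -> b <= s) -> b <= conc_norm x.
Proof. by move=> bx; apply: lb_le_inf => //; exact: (covering_cost_has_inf x).1. Qed.

(** Concatenate the two coverings; on each [lcoord] the domination becomes the triangle inequality
    for real numbers. *)
Lemma covering_costD x y s t : covering_cost x s -> covering_cost y t ->
  covering_cost (conc_add x y) (s + t).
Proof.
move=> [v [vs [v0 xv ->]]] [w [ws [w0 yw ->]]].
exists v, (vs ++ w :: ws); split.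
- by rewrite -cat_cons all_cat v0.
- apply: le_lcoordP => a ata.
  rewrite lcoord_modulus// lcoord_add// lcoord_sum// -cat_cons big_cat/=.
  rewrite -!lcoord_sum// (le_trans (ler_normD _ _))//.
  by rewrite -!lcoord_modulus// lerD// lcoord_le.
- by rewrite -cat_cons big_cat.
Qed.

(** Scale each member of the covering by [|c|] in the new structure: its norm gains the factor [|c|]
    to the power [p^-1], hence its cost the factor [|c|]. *)
Lemma covering_costZ c x s :
  covering_cost x s -> covering_cost (conc_scale c x) (`|c| * s).
Proof.
move=> [v [vs [v0 xv ->]]]; pose f := conc_scale `|c|.
exists (f v), (map f vs); split.
- rewrite -map_cons all_map; apply: sub_all v0 => w /= w0.
  by rewrite scale_ge0// spow_ge0.
- apply: le_lcoordP => a ata.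
  rewrite lcoord_modulus// lcoord_scale// lcoord_sum// -map_cons big_map.
  under eq_bigr do rewrite lcoord_scale//.
  by rewrite -mulr_sumr -lcoord_sum// normrM ler_wpM2l// -lcoord_modulus// lcoord_le.
- rewrite -map_cons big_map mulr_sumr; apply: eq_bigr => w _.
  rewrite normrZ powRM// normr_spow// normr_id ger0_spow// -powRrM mulVf ?gt_eqF//.
  by rewrite powRr1.
Qed.

Lemma conc_norm_scale_le c x : conc_norm (conc_scale c x) <= `|c| * conc_norm x.
Proof.
(* Division by [|c|] is impossible here, but a covering of cost 0 arises by scaling the trivial
   one. *)
have [->|c0] := eqVneq c 0.
  rewrite normr0 mul0r; apply: conc_norm_le.
  have := covering_costZ 0 (covering_cost_modulus x).
  by rewrite normr0 mul0r.
rewrite mulrC -ler_pdivrMr ?normr_gt0//; apply: le_conc_norm => s xs.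
rewrite ler_pdivrMr ?normr_gt0// mulrC.
by apply: conc_norm_le; exact: covering_costZ.
Qed.

Lemma conc_norm_ge0 x : 0 <= conc_norm x.
Proof. by apply: le_conc_norm => s /covering_cost_ge0. Qed.

Lemma conc_lattice_seminorm :
  @is_lattice_seminorm R E conc_add conc_scale conc_norm.
Proof.
split=> [|x y|c x|x y].
- exact: conc_norm_ge0.
- rewrite -lerBlDr; apply: le_conc_norm => s xs.
  rewrite lerBlDr addrC -lerBlDr; apply: le_conc_norm => t yt.
  by rewrite lerBlDr; rewrite addrC; apply: conc_norm_le; exact: covering_costD.
- apply/le_anti; rewrite conc_norm_scale_le/=.
  have [->|c0] := eqVneq c 0; first by rewrite normr0 mul0r conc_norm_ge0.
  have vl := conc_vector_lattice.
  (* The reverse inequality is [conc_norm_scale_le] for the scalar [c^-1] and the element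
     [conc_scale c x]. *)
  rewrite mulrC -ler_pdivlMr ?normr_gt0// mulrC -normfV.
  by rewrite -{1}(vl_scale1 vl x) -(mulVf c0) -(vl_scaleA vl) conc_norm_scale_le.
- rewrite !modulus_conc => xy; apply: le_conc_norm => s [v [vs [v0 yv sE]]].
  by apply: conc_norm_le; exists v, vs; split=> //; exact: le_trans yv.
Qed.

Lemma conc_norm_eq0 x : conc_norm x = 0 -> x = 0.
Proof.
move=> Nx; apply/eqP/negPn/negP => x0.
have [a [ata ax]] : exists a, atom a /\ a <= mod x.
  apply: dE; rewrite lt_def modulus_ge0 andbT.
  by apply: contra_neq x0 => mx; apply: modulus_eq0; rewrite mx.
have na : 0 < `|a| by rewrite normr_gt0 gt_eqF// ata.1.
have : `|a| `^ p <= conc_norm x.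
  apply: le_conc_norm => s [v [vs [v0 xv ->]]].
  have := lcoord_le ata (le_trans ax xv).
  rewrite {1}/lcoord coord_atom// spow1 lcoord_sum// => one_le.
  rewrite -[leLHS]mul1r (le_trans (ler_wpM2r (powR_ge0 _ _) one_le))//.
  rewrite mulr_suml !big_seq; apply: ler_sum => w wv.
  by apply: lcoord_norm_le => //; exact: (allP v0).
by rewrite Nx leNgt powR_gt0.
Qed.

End Concavification.

Theorem corollary7 (R : realType) (E : banachLatticeType R) (p : R) :
  1 <= p -> discrete_lattice E ->
  @is_normed_lattice R E 0 (@conc_add R E p) (@conc_scale R E p)
    (@conc_norm R E p).
Proof.
move=> p1 dE; have p0 : 0 < p by exact: lt_le_trans p1.
split.
- exact: conc_vector_lattice.
- exact: conc_lattice_seminorm.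
- exact: conc_norm_eq0.
Qed.
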